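(* Assume $\mathrm{MA}_{\omega_1}(\sigma\text{-centered})$ and let $2\leq n<\omega$. If $\mathscr{C}\subseteq[\omega_1]^{<\omega}$ is downward closed and $\sigma$-$n$-linked, then there is a coloring $\pi:[\omega_1]^{<n+2}\to 2$ with the following properties. (i) $\mathcal{H}^\pi_0$ is $\sigma$-$n$-linked. (ii) $\mathscr{C}\cap[\omega_1]^{<n+1}\subseteq\mathcal{H}^\pi_0\subseteq\mathscr{C}$.
   Context: For a set $X$ and a cardinal $\kappa$, $[X]^{\kappa}$ and $[X]^{<\kappa}$ denote the sets of subsets of $X$ of size $\kappa$, respectively of size less than $\kappa$. A family $\mathscr{C}\subseteq[\omega_1]^{<\omega}$ is downward closed if $a\subseteq b\in\mathscr{C}$ implies $a\in\mathscr{C}$. It is $\sigma$-$n$-linked if there is a partition $\mathscr{C}=\bigcup_{m<\omega}C_m$ such that $\bigcup F\in\mathscr{C}$ for all $m<\omega$ and all $F\in[C_m]^n$. For a coloring $\pi:[\omega_1]^{<n+2}\to 2$, $\mathcal{H}^\pi_0=\{F\in[\omega_1]^{<\omega}:[F]^{<n+2}\subseteq\pi^{-1}\{0\}\}$, regarded as a poset ordered by reverse inclusion. A subset $X$ of a poset $\mathcal{P}$ is $n$-linked if every $n$-element subset of $X$ has a common lower bound in $\mathcal{P}$, and centered if every finite subset of $X$ has a common lower bound in $\mathcal{P}$. A poset is $\sigma$-$n$-linked (respectively $\sigma$-centered) if it is a countable union of $n$-linked (respectively centered) subsets. $\mathrm{MA}_{\omega_1}(\sigma\text{-centered})$ is the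 assertion that for every $\sigma$-centered poset $\mathcal{P}$ and every collection $\mathcal{X}$ of $\omega_1$ many dense subsets of $\mathcal{P}$ there is a filter $G\subseteq\mathcal{P}$ with $G\cap D\ne\emptyset$ for all $D\in\mathcal{X}$ (dense: downward cofinal; filter: upward closed, any finitely many elements have a common lower bound in it). *)

(* Defs.v *)
From HB Require Import structures.
From mathcomp Require Import all_boot all_order finmap.
From mathcomp Require Import boolp classical_sets functions cardinality wochoice.

Set Implicit Arguments.
Unset Strict Implicit.
Unset Printing Implicit Defensive.
Import Order.TTheory.
Local Open Scope order_scope.
Local Open Scope classical_set_scope.

(* These conditions characterize omega_1 up to a unique order isomorphism. *)
Definition is_omega1 (d : Order.disp_t) (W : orderType d) : Prop :=
  [/\ well_order (fun x y : W => x <= y),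
      forall x : W, countable [set y : W | y < x]
    & ~ countable [set: W]].

Section Poset.
Context {d : Order.disp_t} (P : porderType d).

Definition linked (n : nat) (X : set P) : Prop :=
  forall F : {fset P}, #|` F| = n -> [set` F] `<=` X -> has_lbound [set` F].

(* F may be empty; hence a poset with a centered subset is nonempty. *)
Definition centered (X : set P) : Prop :=
  forall F : {fset P}, [set` F] `<=` X -> has_lbound [set` F].

Definition sigma_linked (n : nat) : Prop :=
  exists X : nat -> set P,
    \bigcup_m X m = [set: P] /\ forall m, linked n (X m).

Definition sigma_centered : Prop :=
  exists X : nat -> set P,
    \bigcup_m X m = [set: P] /\ forall m, centered (X m).

Definition poset_dense (D : set P) : Prop :=
  forall p, exists2 q, D q & q <= p.

(* F may be empty; hence a filter is nonempty. *)
Definition poset_filter (G : set P) : Prop :=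
  (forall p q, p <= q -> G p -> G q) /\
  (forall F : {fset P}, [set` F] `<=` G -> G `&` lbound [set` F] !=set0).

End Poset.

(* MA_kappa(sigma-centered) for kappa the cardinality of the type I: a
   collection of kappa many dense sets is an I-indexed family, repetitions
   allowed. *)
Definition MA_sigma_centered (I : Type) : Prop :=
  forall (d : Order.disp_t) (P : porderType d), sigma_centered P ->
  forall D : I -> set P, (forall i, poset_dense (D i)) ->
  exists2 G : set P, poset_filter G & forall i, G `&` D i !=set0.

Section Families.
Context {T : choiceType}.
Implicit Types C : set {fset T}.

Definition downward_closed C : Prop :=
  forall a b : {fset T}, (a `<=` b)%fset -> C b -> C a.

(* The pieces of the partition may be empty, so that finite families are
   covered. *)
Definition sigma_linked_family (n : nat) C : Prop :=
  exists Cs : nat -> set {fset T},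
    [/\ trivIset setT Cs, \bigcup_m Cs m = C
      & forall (m : nat) (F : {fset {fset T}}),
          #|` F| = n -> [set` F] `<=` Cs m -> C (\bigcup_(a <- F) a)%fset].

Definition fset_lt (k : nat) : set {fset T} := [set F | (#|` F| < k)%N].

End Families.

Definition fsets_lt (T : choiceType) (k : nat) : Type :=
  {F : {fset T} | (#|` F| < k)%N}.

Definition H0 (T : choiceType) (n : nat) (pi : fsets_lt T n.+2 -> 'I_2) :
    set {fset T} :=
  [set F : {fset T} |
    [set G : fsets_lt T n.+2 | (val G `<=` F)%fset] `<=` pi @^-1` [set ord0]].

Definition revincl (T : choiceType) (A : set {fset T}) : Type := set_type A.

Section RevIncl.
Context {T : choiceType} {A : set {fset T}}.

HB.instance Definition _ := Choice.on (revincl A).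

Definition revincl_le (F G : revincl A) : bool := (val G `<=` val F)%fset.

Lemma revincl_le_refl : reflexive revincl_le.
Proof. by move=> F; exact: fsubset_refl. Qed.

Lemma revincl_le_anti : antisymmetric revincl_le.
Proof. move=> F G /andP[GF FG]; apply/val_inj/eqP.
by rewrite eqEfsubset; apply/andP; split. Qed.

Lemma revincl_le_trans : transitive revincl_le.
Proof. by move=> G F K GF KG; exact: fsubset_trans KG GF. Qed.

Fact revincl_display : Order.disp_t. Proof. exact: Order.Disp tt tt. Qed.

HB.instance Definition _ := Order.Le_isPOrder.Build revincl_display (revincl A)
  revincl_le_refl revincl_le_anti revincl_le_trans.

End RevIncl.

(* Main.v *)
From HB Require Import structures.
Require Import Defs.
From mathcomp Require Import all_boot all_order finmap.
From mathcomp Require Import boolp classical_sets functions cardinality wochoice.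

(** The colouring gives 0 exactly to the members of a family H that lies between
the members of C of size at most n and C, is sigma-n-linked, and contains a
finite set as soon as it contains all its subsets of size at most n + 1.

Let omega_1 carry tree orders <=_l (l in nat), increasing in l with union the
order of omega_1, such that the set D l x of points <=_l x is always finite, and
<=_0 is equality (tower); the least l with x <=_l y is then a subadditive
function in the sense of Todorcevic.  Let also sim l be equivalence relations,
finer as l grows, such that similar points have isomorphic sets of predecessors
(similarity).  A finite set a contracts to b at level l if it has no
<=_l-antichain with more than n elements, if b is contained in some D l z, and if
a and b meet the same sim l-classes.  H is generated from the members of C of
size at most n by adding every set that contracts to a set already in H.

H is contained in C (generated_in).  Choose f on finite sets such that the union
of at most n sets with the same f-value as a member of C is in C (linked_rank).
Similarity of x and x' remembers f on the subsets of D l z for all z above x, so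
that x' also lies below a copy of D l z.  If a contracts to b inside D l z, each
of the at most n maximal elements of a lies below such a copy, and a is covered
by the at most n corresponding copies of b, which all have the f-value of b.

H is sigma-n-linked (generated_bigcup).  If n sets a_i in H lie below points z_i
that are similar at level l, and have the same heights there, then each a_i is a
copy of a_0, and their union contracts to a_0.  There are countably many types,
because sim l has finite index on a set of points that exhausts omega_1 as l
grows (profile_eq_finite_index).

Subsets of size n + 1 decide membership (generated_small_subsets).  Suppose that
a lies in some D k z and that H contains all subsets of a of size at most n + 1;
argue by induction on k.  First, a contracts to some b at a level i < k
(contracts_lower).  If b has more than n elements, each subset of b of size n + 1
is a copy of a subset of a, hence in H (generated_contracts_between), and the
induction hypothesis puts b, hence a, in H.  If b has at most n elements, let j
be the last level at which a has at most n similarity classes, and let c be a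
subset of a of size n + 1 that meets all these classes and whose points are
pairwise dissimilar at level j + 1.  Since c is in H and all its contractions
above level j are injective, it contracts to some d in H at a level l <= j.  If
l <= i this contraction factors through b, so b is in H; otherwise it extends
from c to the whole of a.  In both cases a is in H.

Martin's axiom is used to make sim l of finite index: Hechler forcing is
sigma-centered and gives one function that eventually dominates, for each x, the
size of D l x and the values of f on its subsets (MA_bounded).  Before the bounds
take effect at x, the set D l x is cut down to the singleton of x
(tower_threshold). *)

Set Implicit Arguments.
Unset Strict Implicit.
Unset Printing Implicit Defensive.

Import Order.TTheory.
Local Open Scope classical_set_scope.

(** * Finite sets *)

Section FiniteSetLemmas.
Local Open Scope fset_scope.

Lemma leq_card_rel (T T' : choiceType) (r : T -> T' -> Prop) (A : {fset T})
    (B : {fset T'}) : (forall x, x \in A -> exists2 y, y \in B & r x y) ->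
  (forall x x' y, x \in A -> x' \in A -> y \in B -> r x y -> r x' y -> x = x') ->
  (#|` A| <= #|` B|)%N.
Proof.
move=> rAB rinj; have [->|[x0 x0A]] := fset_0Vmem A; first by rewrite cardfs0.
have [y0 _ _] := rAB x0 x0A.
have /choice[f fP] x : exists y, x \in A -> y \in B /\ r x y.
  have [xA|_] := boolP (x \in A); last by exists y0.
  by have [y yB rxy] := rAB x xA; exists y.
have <- : #|` f @` A| = #|` A|.
  apply: card_in_imfset => x x' /= xA x'A ff.
  have [fB rx] := fP _ xA; have [_ rx'] := fP _ x'A.
  by apply: (rinj x x' (f x)) => //; rewrite ff.
by apply/fsubset_leq_card/fsubsetP => _ /imfsetP[x /= xA ->]; case: (fP x xA).
Qed.

Section FiniteSets.
Context {T : choiceType}.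
Implicit Types (A B : {fset T}) (r : T -> T -> Prop).

Lemma fsubset_interpolate A B k : A `<=` B -> (#|` A| <= k)%N ->
  (k <= #|` B|)%N -> exists E, [/\ A `<=` E, E `<=` B & #|` E| = k].
Proof.
move=> AB; elim: k => [|k IH] Ak kB.
  by exists A; split=> //; apply/eqP; rewrite -leqn0.
have [Ek|] := eqVneq #|` A| k.+1; first by exists A.
rewrite neq_ltn => /orP[{}Ak|]; last by rewrite ltnNge Ak.
rewrite ltnS in Ak.
have [E [AE EB Ek]] := IH Ak (ltnW kB).
have /fsubsetPn[x xB xE] : ~~ (B `<=` E).
  by apply/negP => /fsubset_leq_card; rewrite Ek leqNgt kB.
exists (x |` E); split.
- exact: fsubset_trans AE (fsubsetU1 _ _).
- by rewrite fsubUset fsub1set xB.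
- by rewrite cardfsU1 xE Ek.
Qed.

Lemma fset_choice r A B : (forall x, x \in A -> exists2 y, y \in B & r x y) ->
  exists2 f : T -> T, f @` A `<=` B & forall x, x \in A -> r x (f x).
Proof.
move=> rAB.
have /choice[f fP] x : exists y, x \in A -> y \in B /\ r x y.
  have [xA|_] := boolP (x \in A); last by exists x.
  by have [y yB rxy] := rAB x xA; exists y.
exists f => [|x /fP[]//].
by apply/fsubsetP => _ /imfsetP[x /= xA ->]; case: (fP x xA).
Qed.

(** For a symmetric reflexive [r], a maximal set of pairwise unrelated points is
automatically a set of representatives. *)
Lemma fset_independent r A B : (forall x, r x x) ->
  (forall x y, r x y -> r y x) -> B `<=` A ->
  (forall x y, x \in B -> y \in B -> r x y -> x = y) ->
  exists E, [/\ B `<=` E, E `<=` A,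
    forall x y, x \in E -> y \in E -> r x y -> x = y
    & forall x, x \in A -> exists2 y, y \in E & r x y].
Proof.
move=> rxx rC; have [m] := ubnP (#|` A| - #|` B|).
elim: m B => // m IH B; rewrite ltnS => mB BA Bind.
have [full|/existsNP[x /not_implyP[xA xB]]] :=
  pselect (forall x, x \in A -> exists2 y, y \in B & r x y).
  by exists B; split.
have xNB : x \notin B by apply/negP => xB'; apply: xB; exists x.
have xBA : x |` B `<=` A by rewrite fsubUset fsub1set xA.
have [||E [BE EA Eind Efull]] := IH (x |` B) _ xBA.
- rewrite cardfsU1 xNB; apply: leq_trans mB; rewrite ltn_sub2l ?addn1 //.
  by apply: leq_trans (fsubset_leq_card xBA); rewrite cardfsU1 xNB.
- move=> y z /fset1UP[->|yB] /fset1UP[->|zB] // ryz.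
  + by case: xB; exists z.
  + by case: xB; exists y => //; exact: rC.
  + exact: Bind.
- by exists E; split=> //; exact: fsubset_trans (fsubsetU1 _ _) BE.
Qed.

End FiniteSets.
End FiniteSetLemmas.

(** * Towers of tree orders and similarities *)

Section TowerDefinitions.
Local Open Scope fset_scope.

(** [D l x] is the set of predecessors of [x], itself included, in the tree order
of level [l]. *)
Record tower (T : choiceType) (D : nat -> T -> {fset T}) : Prop := Tower {
  tower_refl : forall l x, x \in D l x;
  tower_trans : forall l x y z, x \in D l y -> y \in D l z -> x \in D l z;
  tower_anti : forall l x y, x \in D l y -> y \in D l x -> x = y;
  tower_tree : forall l x y z, x \in D l z -> y \in D l z ->
    x \in D l y \/ y \in D l x;
  tower_mono : forall j l x, (j <= l)%N -> D j x `<=` D l x;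
  tower0 : forall x, D 0 x = [fset x];
  tower_total : forall x y, exists l, x \in D l y \/ y \in D l x }.

(** [sim_down] makes the predecessors of similar points correspond, at the level
of the similarity and below; by [sim_branch] the correspondence is unique. *)
Record similarity (T : choiceType) (D : nat -> T -> {fset T})
    (sim : nat -> T -> T -> Prop) : Prop := Similarity {
  sim_refl : forall l x, sim l x x;
  sim_sym : forall l x y, sim l x y -> sim l y x;
  sim_trans : forall l x y z, sim l x y -> sim l y z -> sim l x z;
  sim_mono : forall j l x y, (j <= l)%N -> sim l x y -> sim j x y;
  sim_down : forall j l x x' y, (j <= l)%N -> sim l x x' -> y \in D j x ->
    exists2 y', y' \in D j x' & sim l y y';
  sim_branch : forall l x y z, x \in D l z -> y \in D l z -> sim l x y ->
    x = y }.

End TowerDefinitions.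

(** * The family generated by contractions *)

Section Contraction.
Local Open Scope fset_scope.
Context {T : choiceType} (D : nat -> T -> {fset T}) (sim : nat -> T -> T -> Prop).
Context (n : nat) (C : set {fset T}).
Context (towerD : tower D) (simD : similarity D sim) (n1 : (0 < n)%N).
Implicit Types (a b c d F G : {fset T}).

Let trefl := tower_refl towerD.
Let ttrans := tower_trans towerD.
Let tmono := tower_mono towerD.
Let ssym := sim_sym simD.
Let strans := sim_trans simD.
Let smono := sim_mono simD.
Let srefl := sim_refl simD.
Let sbranch := sim_branch simD.

Definition branch l a := exists z, a `<=` D l z.

Definition antichain l a :=
  forall x y, x \in a -> y \in a -> x \in D l y -> x = y.

Definition narrow l a :=
  forall b, b `<=` a -> antichain l b -> (#|` b| <= n)%N.

Definition independent l a :=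
  forall x y, x \in a -> y \in a -> sim l x y -> x = y.

Definition contracts l a a' :=
  [/\ forall x, x \in a -> exists2 y, y \in a' & sim l x y,
      forall y, y \in a' -> exists2 x, x \in a & sim l x y,
      branch l a' & narrow l a].

(** Going from [a'] to [a] glues together at most [n] partial copies of [a']. *)
Inductive generated : {fset T} -> Prop :=
| generated_small a : C a -> (#|` a| <= n)%N -> generated a
| generated_expand l a a' :
    generated a' -> contracts l a a' -> generated a.

Lemma branch_sub l a b : b `<=` a -> branch l a -> branch l b.
Proof. by move=> ba [z az]; exists z; exact: fsubset_trans ba az. Qed.

Lemma branch_mono j l a : (j <= l)%N -> branch j a -> branch l a.
Proof. by move=> jl [z az]; exists z; apply: fsubset_trans az (tmono _ jl). Qed.

Lemma branch_sim l a x y : branch l a -> x \in a -> y \in a -> sim l x y -> x = y.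
Proof. by move=> [z /fsubsetP az] /az xz /az yz; exact: sbranch xz yz. Qed.

Lemma antichain_mono j l a : (j <= l)%N -> antichain l a -> antichain j a.
Proof.
by move=> jl al x y xa ya /(fsubsetP (tmono _ jl)); exact: al.
Qed.

Lemma narrow_sub l a b : b `<=` a -> narrow l a -> narrow l b.
Proof. by move=> ba na e eb; apply: na; exact: fsubset_trans eb ba. Qed.

Lemma narrow_mono j l a : (j <= l)%N -> narrow j a -> narrow l a.
Proof. by move=> jl na e ea /(antichain_mono jl); exact: na. Qed.

Lemma branch_narrow l a : branch l a -> narrow l a.
Proof.
move=> [z /fsubsetP az] b /fsubsetP ba anb.
have [->|[x xb]] := fset_0Vmem b; first by rewrite cardfs0.
suff /fsubset_leq_card bx : b `<=` [fset x].
  by apply: leq_trans bx _; rewrite cardfs1.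
apply/fsubsetP => y yb; rewrite inE; apply/eqP.
by case: (tower_tree towerD (az _ (ba _ xb)) (az _ (ba _ yb))) => /anb ->.
Qed.

(** The copy of [y] below [x'] provided by [sim_down] can only be [y'], as both lie
on the branch of [z]. *)
Lemma sim_pres j l x y x' y' z : (j <= l)%N -> sim l x x' -> sim l y y' ->
  x' \in D l z -> y' \in D l z -> y \in D j x -> y' \in D j x'.
Proof.
move=> jl sx sy x'z y'z /(sim_down simD jl sx)[w wx' syw].
suff -> : y' = w by [].
apply: (sbranch y'z (ttrans (fsubsetP (tmono x' jl) _ wx') x'z)).
exact: strans (ssym sy) syw.
Qed.

(** An antichain of the contracted set lifts to an antichain of the original, since
the tree order of level [j] passes to copies. *)
Lemma narrow_sim j l a a' : (j <= l)%N -> branch l a' ->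
  (forall y, y \in a' -> exists2 x, x \in a & sim l x y) ->
  narrow j a -> narrow j a'.
Proof.
move=> jl cha' aa' na b' b'a' anb'.
have [|f fa rf] := @fset_choice _ (fun y x => sim l x y) b' a.
  by move=> y /(fsubsetP b'a'); exact: aa'.
have chb' : branch l b' := branch_sub b'a' cha'.
have finj : {in b' &, injective f}.
  move=> y y' yb y'b ff; apply: (branch_sim chb') => //.
  by apply: strans (ssym (rf y yb)) _; rewrite ff; exact: rf.
have <- : #|` f @` b'| = #|` b'| by exact: card_in_imfset.
apply: na => //.
move=> _ _ /imfsetP[y /= yb ->] /imfsetP[y' /= y'b ->] xx'; congr f.
have [z /fsubsetP b'z] := chb'; apply: anb' => //.
exact: sim_pres jl (rf _ y'b) (rf _ yb) (b'z _ y'b) (b'z _ yb) xx'.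
Qed.

(** Similarity at level [l] refines similarity at level [j], so the points of [b]
inherit partners in [c]; the width of [b] is bounded by [narrow_sim]. *)
Lemma contracts_factor j l a b c : (j <= l)%N -> contracts l a b ->
  contracts j a c -> contracts j b c.
Proof.
move=> jl [ab ba chb _] [ac ca chc na]; split=> // [y /ba[x xa sxy]|z /ca[x xa sxz]|].
- have [z zc sxz] := ac _ xa; exists z => //.
  exact: strans (ssym (smono jl sxy)) sxz.
- have [y yb sxy] := ab _ xa; exists y => //.
  exact: strans (ssym (smono jl sxy)) sxz.
- exact: narrow_sim chb ba na.
Qed.

(** Width is a separate hypothesis because an antichain of [a] at level [j] need not
remain one in [b]. *)
Lemma contracts_trans j l a b c : (j <= l)%N -> narrow j a ->
  contracts l a b -> contracts j b c -> contracts j a c.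
Proof.
move=> jl na [ab ba chb _] [bc cb chc _].
split=> // [x /ab[y /bc[z zc syz] sxy]|z /cb[y /ba[x xa sxy] syz]].
- by exists z => //; exact: strans (smono jl sxy) syz.
- by exists x => //; exact: strans (smono jl sxy) syz.
Qed.

Lemma contracts_sym l a b : branch l a -> contracts l a b -> contracts l b a.
Proof.
move=> cha [ab ba chb _]; split=> // [y /ba[x xa sxy]|x /ab[y yb sxy]|].
- by exists x => //; exact: ssym.
- by exists y => //; exact: ssym.
- exact: branch_narrow.
Qed.

Lemma contracts_sub l a a' b : b `<=` a -> contracts l a a' ->
  exists2 b', b' `<=` a' & contracts l b b'.
Proof.
move=> /fsubsetP ba [aa' a'a cha' na].
exists [fset y in a' | `[< exists2 x, x \in b & sim l x y >]]; first exact: fset_sub.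
split.
- move=> x xb; have [y ya' sxy] := aa' _ (ba _ xb); exists y => //.
  by rewrite !inE ya'; apply/asboolP; exists x.
- by move=> y; rewrite !inE => /andP[_ /asboolP].
- by apply: branch_sub cha'; exact: fset_sub.
- by apply: narrow_sub na; exact/fsubsetP.
Qed.

(** Adding to [c] points similar to points of [c] does not change its contractions,
as long as the width remains bounded. *)
Lemma contracts_cover l a b c : narrow l a -> c `<=` a ->
  (forall x, x \in a -> exists2 y, y \in c & sim l x y) ->
  contracts l c b -> contracts l a b.
Proof.
move=> na /fsubsetP ca ac [cb bc chb _].
split=> // [x /ac[y /cb[z zb syz] sxy]|z /bc[y yc syz]].
- by exists z => //; exact: strans sxy syz.
- by exists y => //; exact: ca.
Qed.

Lemma contracts_card l a b : contracts l a b -> (#|` b| <= #|` a|)%N.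
Proof.
move=> [_ ba chb _]; apply: (@leq_card_rel _ _ (fun y x => sim l x y)) => //.
by move=> y y' x yb y'b _ sxy /(strans (ssym sxy)); exact: (branch_sim chb).
Qed.

Lemma contracts_card_independent j l a b : (j <= l)%N -> independent j a ->
  contracts l a b -> #|` b| = #|` a|.
Proof.
move=> jl inda cab; apply/eqP; rewrite eqn_leq (contracts_card cab) /=.
have [ab _ _ _] := cab; apply: (leq_card_rel ab).
by move=> x x' y xa x'a _ sxy /ssym/(strans sxy)/(smono jl); exact: inda.
Qed.

Lemma contracts_independent j l a b : (j <= l)%N -> independent j a ->
  contracts l a b -> independent j b.
Proof.
move=> jl inda [ab ba chb _] y y' yb y'b syy'; apply: (branch_sim chb) => //.
have [x xa sxy] := ba _ yb; have [x' x'a sxy'] := ba _ y'b.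
suff xx' : x = x' by rewrite -xx' in sxy'; exact: strans (ssym sxy) sxy'.
apply: inda => //; apply: strans (smono jl sxy) _.
exact: strans syy' (ssym (smono jl sxy')).
Qed.

Lemma branch_independent l a : branch l a -> independent l a.
Proof. by move=> cha x y xa ya; exact: (branch_sim cha). Qed.

Lemma generated_sub a b : downward_closed C ->
  generated a -> b `<=` a -> generated b.
Proof.
move=> Cdown Ha; elim: Ha b => [{}a Ca an b ba|l {}a a' _ IH caa' b ba].
  by apply: generated_small; [exact: Cdown Ca | exact: leq_trans (fsubset_leq_card ba) an].
have [b' b'a' cbb'] := contracts_sub ba caa'.
exact: generated_expand (IH _ b'a') cbb'.
Qed.

Definition maximals l a :=
  [fset x in a | `[< forall y, y \in a -> x \in D l y -> x = y >]].

Lemma maximals_sub l a : maximals l a `<=` a.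
Proof. exact: fset_sub. Qed.

Lemma maximals_antichain l a : antichain l (maximals l a).
Proof.
by move=> x y; rewrite !inE => /andP[_ /asboolP xmax] /andP[ya _]; exact: xmax.
Qed.

Lemma maximals_mono j l a : (j <= l)%N -> maximals l a `<=` maximals j a.
Proof.
move=> jl; apply/fsubsetP => x; rewrite !inE => /andP[-> /asboolP xmax].
by apply/asboolP => y ya /(fsubsetP (tmono y jl)); exact: xmax.
Qed.

(** Going up from [y] strictly decreases the number of points of [a] above. *)
Lemma maximals_above l a y : y \in a -> exists2 x, x \in maximals l a & y \in D l x.
Proof.
have [m] := ubnP #|` [fset z in a | y \in D l z]|.
elim: m y => // m IH y; rewrite ltnS => ym ya.
have [ymax|/existsNP[z /not_implyP[za /not_implyP[yz ney]]]] :=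
  pselect (forall z, z \in a -> y \in D l z -> y = z).
  by exists y; rewrite ?trefl // !inE ya; exact/asboolP.
have [||x xmax zx] := IH z; [|by []|by exists x => //; exact: ttrans yz zx].
apply: leq_trans ym; apply: fproper_ltn_card; rewrite fproperE; apply/andP; split.
  apply/fsubsetP => w; rewrite !inE => /andP[-> zw]; exact: ttrans yz zw.
apply/fsubsetPn; exists y; rewrite !inE ya ?trefl //=.
by apply/negP => zy; apply: ney; exact: (tower_anti towerD) yz zy.
Qed.

(** In a tree order elements with a common upper bound are comparable, so distinct
members of an antichain lie below distinct maximal elements. *)
Lemma antichain_maximals l a b : b `<=` a -> antichain l b ->
  (#|` b| <= #|` maximals l a|)%N.
Proof.
move=> /fsubsetP ba anb.
apply: (@leq_card_rel _ _ (fun y x => y \in D l x)) => [y /ba|y y' x yb y'b _ yx y'x].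
  exact: maximals_above.
by case: (tower_tree towerD yx y'x) => [/anb|/anb] ->.
Qed.

(** What similarity has to know about [C]: each point of [X] lies below a copy of
[D l z], so [a] is covered by at most [n] copies of [a']; the union of so many
copies is expected to remain in [C]. *)
Definition amalgamates := forall l z a' X a, a' `<=` D l z -> C a' ->
  (#|` X| <= n)%N -> (forall x, x \in X -> exists2 w, w \in D l z & sim l x w) ->
  (forall y, y \in a -> (exists2 x, x \in X & y \in D l x) /\
                       (exists2 w, w \in a' & sim l y w)) -> C a.

Lemma generated_in : amalgamates -> (generated `<=` C)%classic.
Proof.
move=> amC a; elim=> // l {}a a' _ Ca' [aa' a'a [z a'z] na].
apply: (amC l z a' (maximals l a)) => //.
- by apply: na; [exact: maximals_sub | exact: maximals_antichain].
- move=> x /(fsubsetP (maximals_sub _ _))/aa'[w wa' sxw].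
  by exists w => //; exact: (fsubsetP a'z).
- by move=> y ya; split; [exact: maximals_above | exact: aa'].
Qed.

Lemma branch_top l a y : branch l a -> y \in a -> exists2 x, x \in a & a `<=` D l x.
Proof.
move=> [z /fsubsetP az] /(maximals_above l)[x xmax _].
have := xmax; rewrite !inE => /andP[xa /asboolP xtop]; exists x => //.
apply/fsubsetP => w wa.
by case: (tower_tree towerD (az _ wa) (az _ xa)) => // /(xtop _ wa) <-.
Qed.

(** A contraction at level [k] or above of a set that lies on a branch of level [k]
is an isomorphism, hence can be skipped; what remains at the end is a contraction
below [k] because [a] is too large to be a generator. *)
Lemma generated_contracts_lower k a : generated a -> (n < #|` a|)%N ->
  branch k a -> exists l b, [/\ (l < k)%N, generated b & contracts l a b].
Proof.
elim=> [{}a _ an|l {}a b Hb IH cab] na cha; first by rewrite ltnNge an in na.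
have [lk|kl] := ltnP l k; first by exists l, b.
have cla := branch_mono kl cha.
have chb : branch k b.
  have [ab ba [w /fsubsetP bw] _] := cab.
  have [a0|[y ya]] := fset_0Vmem a; first by rewrite a0 cardfs0 in na.
  have [x xa /fsubsetP ax] := branch_top cha ya.
  have [x' x'b sxx'] := ab _ xa; exists x'; apply/fsubsetP => y' y'b.
  have [u ua suy'] := ba _ y'b.
  exact: sim_pres kl sxx' suy' (bw _ x'b) (bw _ y'b) (ax _ ua).
have nb : (n < #|` b|)%N.
  by rewrite (contracts_card_independent (leqnn l) (branch_independent cla) cab).
have [j [d [jk Hd cbd]]] := IH nb chb.
exists j, d; split=> //.
exact: (contracts_factor (leq_trans (ltnW jk) kl) (contracts_sym cla cab)).
Qed.

(** Contractions of [a] at level [j] or above are injective, so they lead to a set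
that is still too large to be a generator.  The first contraction below [j]
either factors through [b], when its level is at most [i], or composes with the
previous ones; the width of [a] at level [i] makes this composition legitimate. *)
Lemma generated_contracts_between i j a b : generated a -> (n < #|` a|)%N ->
  independent j a -> (i <= j)%N -> contracts i a b ->
  generated b \/
  exists l d, [/\ (i <= l < j)%N, generated d & contracts l a d].
Proof.
move=> Ha na inda ij; elim: Ha na inda => [{}a _ an|l {}a d Hd IH cad] na inda cab.
  by rewrite ltnNge an in na.
have [li|il] := leqP l i.
  by left; exact: generated_expand Hd (contracts_factor li cab cad).
have [lj|jl] := ltnP l j; first by right; exists l, d; rewrite (ltnW il).
have nd : (n < #|` d|)%N by rewrite (contracts_card_independent jl inda cad).
have cdb := contracts_factor (ltnW il) cad cab.
have [|[m [e [/andP[im mj] He cde]]]] :=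
  IH nd (contracts_independent jl inda cad) cdb; first by left.
right; exists m, e; rewrite im mj; split=> //.
apply: contracts_trans cad cde; first exact: leq_trans (ltnW mj) jl.
by have [_ _ _ ia] := cab; exact: narrow_mono im ia.
Qed.


(** * Membership is decided by small subsets *)

(** At level 0 every set is an antichain. *)
Lemma narrow0 a : narrow 0 a -> (#|` a| <= n)%N.
Proof.
by apply=> // x y _ _; rewrite (tower0 towerD) inE => /eqP.
Qed.

Lemma contracts_image l z a : narrow l a ->
  (forall x, x \in a -> exists2 y, y \in D l z & sim l x y) ->
  exists b, contracts l a b.
Proof.
move=> na az; exists [fset y in D l z | `[< exists2 x, x \in a & sim l x y >]].
split=> // [x xa|y|]; last by exists z; exact: fset_sub.
- have [y yz sxy] := az _ xa; exists y => //.
  by rewrite !inE yz; apply/asboolP; exists x.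
- by rewrite !inE => /andP[_ /asboolP].
Qed.

(** Let [l + 1] be the first level at which [a] is narrow, and [b] a set of [n + 1]
elements maximal at level [l], among which all those maximal at level [l + 1].
The set [b] is generated, and a contraction that shows it must happen above [l].
As [a] lies below the maximal elements, it is contracted along with [b]. *)
Lemma contracts_lower k a : branch k a -> (n < #|` a|)%N ->
  (forall b, b `<=` a -> (#|` b| <= n.+1)%N -> generated b) ->
  exists l b, (l < k)%N /\ contracts l a b.
Proof.
move=> cha na Hsmall.
have [l /asboolP nal lmin] :
    {l | `[< narrow l a >] & forall j, `[< narrow j a >] -> (l <= j)%N}.
  have ex : exists l, `[< narrow l a >] by exists k; apply/asboolP; exact: branch_narrow.
  by exists (ex_minn ex); case: ex_minnP.
case: l nal lmin => [/narrow0|l nal lmin]; first by rewrite leqNgt na.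
have /existsNP[e /not_implyP[ea /not_implyP[ane /negP]]] : ~ narrow l a.
  by move=> /asboolP/lmin; rewrite ltnn.
rewrite -ltnNge => ne.
have [b [Xb bM bn]] : exists b,
    [/\ maximals l.+1 a `<=` b, b `<=` maximals l a & #|` b| = n.+1].
  apply: fsubset_interpolate; first exact: maximals_mono.
  - apply: leqW; apply: nal; [exact: maximals_sub | exact: maximals_antichain].
  - exact: leq_trans ne (antichain_maximals ea ane).
have ba : b `<=` a := fsubset_trans bM (maximals_sub _ _).
have anb : antichain l b.
  move=> x y /(fsubsetP bM) xM /(fsubsetP bM) yM; exact: maximals_antichain xM yM.
have [||j [d [jk Hd [bd _ [z dz] nb]]]] :=
  generated_contracts_lower (Hsmall b ba _) _ (branch_sub ba cha); rewrite ?bn //.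
have lj : (l < j)%N.
  rewrite ltnNge; apply/negP => jl.
  by have := nb _ (fsubset_refl b) (antichain_mono jl anb); rewrite bn ltnn.
have [c ac] : exists c, contracts j a c.
  apply: (contracts_image (z := z)) (narrow_mono lj nal) _ => y ya.
  have [x xX yx] := maximals_above l.+1 ya.
  have [w wd sxw] := bd _ (fsubsetP Xb _ xX).
  have [v vw syv] := sim_down simD (leqnn j) sxw (fsubsetP (tmono x lj) _ yx).
  by exists v => //; exact: ttrans vw (fsubsetP dz _ wd).
by exists j, c.
Qed.

(** The induction lowers [k]: a contraction of [a] lies on a branch of a lower level,
and it inherits the hypothesis on small subsets if it is large enough. *)
Theorem generated_small_subsets k a : downward_closed C -> branch k a ->
  (forall b, b `<=` a -> (#|` b| <= n.+1)%N -> generated b) -> generated a.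
Proof.
move=> Cdown; elim/ltn_ind: k a => k IH a cha Hsmall.
have [an|na] := leqP #|` a| n.+1; first exact: Hsmall.
have [i [g [ik ag]]] := contracts_lower cha (ltnW na) Hsmall.
have [_ ga chg ia] := ag.
(* If g is large, every subset of g of size n + 1 is a copy of a subset of a. *)
have [gn|ng] := ltnP n #|` g|.
  apply: (generated_expand _ ag); apply: (IH i ik) => // b bg bn.
  have [e [be eg en]] := fsubset_interpolate bg bn gn.
  apply: generated_sub be => //.
  have [|f fa rf] := @fset_choice _ (fun y x => sim i x y) e a.
    by move=> y /(fsubsetP eg); exact: ga.
  have finj : {in e &, injective f}.
    move=> x y xe ye ff; apply: (branch_sim (branch_sub eg chg)) => //.
    by apply: strans (ssym (rf x xe)) _; rewrite ff; exact: rf.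
  have fn : #|` f @` e| = n.+1 by rewrite -en; exact: card_in_imfset.
  have fe : contracts i (f @` e) e.
    split=> [_ /imfsetP[y /= ye ->]|y ye||].
    - by exists y => //; exact: rf.
    - by exists (f y); [exact: in_imfset | exact: rf].
    - exact: branch_sub chg.
    - exact: narrow_sub ia.
  have Hf : generated (f @` e) by apply: Hsmall; rewrite ?fn.
  have [||//|[l [d [/andP[il li] _ _]]]] :=
    generated_contracts_between Hf _ _ (leqnn i) fe; first by rewrite fn.
    move=> _ _ /imfsetP[x /= xe ->] /imfsetP[y /= ye ->] sff; congr f.
    apply: (branch_sim (branch_sub eg chg)) => //.
    exact: strans (ssym (rf _ xe)) (strans sff (rf _ ye)).
  by move: (leq_ltn_trans il li); rewrite ltnn.
(* Otherwise take the last level j at which a has at most n similarity classes. *)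
pose few j := `[< forall b, b `<=` a -> independent j b -> (#|` b| <= n)%N >].
have fewk j : few j -> (j <= k)%N.
  move=> /asboolP fewj; rewrite leqNgt; apply/negP => kj.
  have := fewj _ (fsubset_refl a) (branch_independent (branch_mono (ltnW kj) cha)).
  by rewrite leqNgt (ltnW na).
have fewi : few i.
  apply/asboolP => b /fsubsetP ba indb; apply: leq_trans ng.
  have [ag' _ _ _] := ag.
  apply: (@leq_card_rel _ _ (sim i)) => [x /ba|x y z xb yb _ sxz syz]; first exact: ag'.
  by apply: indb => //; exact: strans sxz (ssym syz).
have [j fewj jmax] : {j | few j & forall l, few l -> (l <= j)%N}.
  have ex : exists l, few l by exists i.
  by exists (ex_maxn ex fewk); case: ex_maxnP.
have ij : (i <= j)%N := jmax _ fewi.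
have [r [_ ra rind rfull]] := fset_independent (srefl j) (@ssym j) (fsub0set a)
  (fun x y (xb : x \in fset0) _ _ => False_ind _ (notF xb)).
have rn : (#|` r| <= n)%N by move/asboolP: fewj; apply.
have rind1 : independent j.+1 r by move=> x y xr yr /(smono (leqnSn j)); exact: rind.
(* The set c meets each class of level j and has n + 1 classes at level j + 1. *)
have [c [rc ca cn cind]] : exists c,
    [/\ r `<=` c, c `<=` a, #|` c| = n.+1 & independent j.+1 c].
  have /existsNP[e /not_implyP[/fsubsetP ea /not_implyP[inde /negP]]] :
      ~ forall b, b `<=` a -> independent j.+1 b -> (#|` b| <= n)%N.
    by move=> /asboolP/jmax; rewrite ltnn.
  rewrite -ltnNge => ne.
  have [m [rm ma mind mfull]] := fset_independent (srefl j.+1) (@ssym j.+1) ra rind1.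
  have nm : (n < #|` m|)%N.
    apply: leq_trans ne _.
    apply: (@leq_card_rel _ _ (sim j.+1)) => [x /ea|x y z xe ye _ sxz syz]; first exact: mfull.
    by apply: inde => //; exact: strans sxz (ssym syz).
  have [c [rc cm cn]] := fsubset_interpolate rm (leqW rn) nm.
  exists c; split=> //; first exact: fsubset_trans cm ma.
  by move=> x y /(fsubsetP cm) xm /(fsubsetP cm) ym; exact: mind.
have cfull l : (l <= j)%N -> forall x, x \in a -> exists2 y, y \in c & sim l x y.
  move=> lj x /rfull[y yr sxy]; exists y; first exact: (fsubsetP rc).
  exact: smono lj sxy.
have cg : contracts i c g.
  have [ag' _ _ _] := ag; split=> // [x /(fsubsetP ca)|y /ga[x xa sxy]|].
  - exact: ag'.
  - have [w wc sxw] := cfull i ij x xa; exists w => //.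
    exact: strans (ssym sxw) sxy.
  - exact: narrow_sub ca ia.
have Hc : generated c by apply: Hsmall; rewrite ?cn.
have [|Hg|[l [d [/andP[il lj] Hd cd]]]] :=
  generated_contracts_between Hc _ cind (leqW ij) cg; first by rewrite cn.
  exact: generated_expand Hg ag.
apply: generated_expand Hd _.
exact: contracts_cover (narrow_mono il ia) ca (cfull l lj) cd.
Qed.

(** Each member of [A] lies on a branch, so an antichain has at most one point in
each; hence the union has width at most [n] and contracts to [b]. *)
Lemma generated_bigcup l b (A : {fset {fset T}}) : generated b -> b \in A ->
  branch l b -> (#|` A| <= n)%N ->
  (forall a, a \in A -> branch l a /\
     forall x, x \in a -> exists2 y, y \in b & sim l x y) ->
  generated (\bigcup_(a <- A) a).
Proof.
move=> Hb bA chb An Ab; apply: (generated_expand Hb (l := l)); split=> //.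
- by move=> x /bigfcupP[a /andP[/Ab[_ ab] _] /ab].
- by move=> y yb; exists y => //; apply/bigfcupP; exists b; rewrite ?bA.
- move=> e /fsubsetP eA ane; apply: leq_trans An.
  apply: (@leq_card_rel _ _ (fun (x : T) (a : {fset T}) => x \in a)) => [x /eA|].
    by move=> /bigfcupP[a /andP[aA _] xa]; exists a.
  move=> x y a xe ye aA xa ya; have [[z /fsubsetP az] _] := Ab a aA.
  by case: (tower_tree towerD (az _ xa) (az _ ya)) => /ane ->.
Qed.

End Contraction.

(** * A tower on omega_1 *)

(** Dependent choice along a well-founded relation, for a specification of the value
at [b] that only looks at the values below [b]. *)
Lemma wf_choice (T V : Type) (R : T -> T -> Prop) (v0 : V)
    (spec : (T -> V) -> T -> V -> Prop) : well_founded R ->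
  (forall P P' b v, (forall x, R x b -> P x = P' x) -> spec P b v -> spec P' b v) ->
  (forall P b, (forall x, R x b -> spec P x (P x)) -> exists v, spec P b v) ->
  exists P, forall b, spec P b (P b).
Proof.
move=> wfR local ext.
pose below b (rec : forall x, R x b -> V) x :=
  if pselect (R x b) is left xb then rec x xb else v0.
pose pick b (rec : forall x, R x b -> V) :=
  if pselect (exists v, spec (below b rec) b v) is left h then projT1 (cid h) else v0.
pose P := Fix wfR (fun=> V) pick.
have PE b : P b = pick b (fun x _ => P x).
  apply: (Fix_eq wfR (fun=> V) pick) => x f g fg; congr pick.
  by apply: functional_extensionality_dep => y; apply: functional_extensionality_dep.
exists P; elim/(well_founded_ind wfR) => b IH.
have belowE x : R x b -> below b (fun x _ => P x) x = P x.
  by rewrite /below; case: pselect.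
rewrite PE /pick; case: pselect => [h|]; last first.
  case; have [v vP] := ext P b IH; exists v.
  by apply: local vP => x xb; rewrite belowE.
by case: cid => v /= vP; apply: local vP => x xb; exact: belowE.
Qed.

Section Tower.
Local Open Scope order_scope.
Local Open Scope fset_scope.
Context {d : Order.disp_t} {W : orderType d}.
Implicit Types (P : W -> nat -> {fset W}) (Q : nat -> {fset W}).

Lemma well_order_founded : well_order (fun x y : W => x <= y) ->
  well_founded (fun x y : W => x < y).
Proof.
move=> wo x; apply: contrapT => nAx.
have [|z [[/asboolP nAz zmin] _]] := wo [pred y | `[< ~ Acc (fun x y : W => x < y) y >]].
  by exists x; apply/asboolP.
case: nAz; constructor => y yz; apply: contrapT => nAy.
by have := zmin y (asboolT nAy); rewrite leNgt yz.
Qed.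

(** [Q l] is to become the set of strict predecessors of [b] at level [l], given the
predecessors [P x l] of the points [x < b]; [pred_coherent] says that the result
is a tree order. *)
Record predecessors P b Q : Prop := Predecessors {
  pred_lt : forall l x, x \in Q l -> x < b;
  pred_mono : forall l, Q l `<=` Q l.+1;
  pred0 : Q 0%N = fset0;
  pred_cover : forall x, x < b -> exists l, x \in Q l;
  pred_coherent : forall l x y, x \in Q l ->
    (y \in P x l) = (y \in Q l) && (y < x) }.

(** Let [Q l] be the set of points [<=_l] some [g l < b].  This works as soon as
[g l <=_(l+1) g (l+1)] and each point below [b] is eventually below [g l].  For
this, [g] runs through the maxima of longer and longer pieces of an enumeration
of the points below [b], and waits at each of them until the next one is above it
in the current tree order. *)
Lemma predecessors_extend P b : countable [set y : W | y < b] ->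
  (forall x, x < b -> predecessors P x (P x)) -> exists Q, predecessors P b Q.
Proof.
move=> cb Pb.
have [[x0 x0b]|none] := pselect (exists x, x < b); last first.
  exists (fun=> fset0); split=> // x xb; by case: none; exists x.
pose D l x := x |` P x l.
have Drefl l x : x \in D l x by rewrite fset1U1.
have Dmono j l x y : x < b -> (j <= l)%N -> y \in D j x -> y \in D l x.
  move=> xb /subnK <-; elim: (l - j)%N => // k IH /IH.
  by rewrite !inE => /orP[->//|/(fsubsetP (pred_mono (Pb x xb) _))->]; rewrite orbT.
have Dtrans l x y z : z < b -> x \in D l y -> y \in D l z -> x \in D l z.
  move=> zb xy /fset1UP[yz|yz]; first by rewrite -yz.
  move: xy => /fset1UP[->|xy]; apply/fset1UP; right => //.
  by move: xy; rewrite (pred_coherent (Pb z zb)) // => /andP[].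
have [e eb ecov] : exists2 e : nat -> W, forall i, e i < b &
    forall x, x < b -> exists i, e i = x.
  have /countable_injP[f finj] := cb.
  have /choice[e eP] i : exists x, x < b /\ forall y, y < b -> f y = i -> y = x.
    have [[x [xb fx]]|no] := pselect (exists x, x < b /\ f x = i).
      exists x; split=> // y yb fy; apply: finj; rewrite ?inE ?mem_setE //.
      by rewrite fx fy.
    by exists x0; split=> // y yb fy; case: no; exists y.
  exists e => [i|x xb]; first by case: (eP i).
  by exists (f x); case: (eP (f x)) => _ /(_ x xb erefl).
(* A state is the current value of g and the number of points enumerated. *)
pose step l (s : W * nat) := let t := Order.max s.1 (e s.2) in
  if s.1 \in D l.+1 t then (t, s.2.+1) else s.
pose s := fix s l := if l is k.+1 then step k (s k) else (e 0%N, 0%N).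
pose g l := (s l).1.
have maxb x i : x < b -> Order.max x (e i) < b by move=> xb; rewrite gt_max xb eb.
have gb l : g l < b.
  rewrite /g; elim: l => [|l IH] /=; first exact: eb.
  by rewrite /step; case: ifP => //= _; exact: maxb.
have gS l : g l \in D l.+1 (g l.+1).
  by rewrite /g /= /step; case: ifP => //= _; rewrite Drefl.
have gle j l : (j <= l)%N -> g j \in D l (g l).
  move=> /subnK <-; elim: (l - j)%N => [|k IH]; first exact: Drefl.
  by apply: Dtrans (gS _); [exact: gb|apply: Dmono IH; rewrite ?gb ?leqnSn].
have sfirst m : exists l, (s l).2 = m.
  elim: m => [|m [l slm]]; first by exists 0%N.
  apply: contrapT => never.
  have stay k : s (l + k)%N = s l.
    elim: k => [|k IH]; first by rewrite addn0.
    have := never; rewrite addnS /= IH /step; case: ifP => // h.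
    case; exists (l + k).+1; rewrite /= IH /step h /=; congr _.+1; exact: slm.
  have [k gk] : exists k, g l \in D k (Order.max (g l) (e m)).
    have := le_max (g l) (g l) (e m); rewrite lexx /= le_eqVlt => /orP[/eqP <-|lt].
      by exists 0%N.
    have [k gk] := pred_cover (Pb _ (maxb _ m (gb l))) lt.
    by exists k; rewrite !inE gk orbT.
  apply: never; exists (l + k).+1; rewrite /= stay /step slm -/(g l).
  by rewrite (Dmono k) ?maxb ?gb //= ?slm // leqW // leq_addl.
have sbound l : forall m, (m < (s l).2)%N -> e m <= g l.
  rewrite /g; elim: l => //= l IH m; rewrite /step; case: ifP => /= _; last exact: IH.
  by rewrite ltnS leq_eqVlt le_max => /orP[/eqP->|/IH->//]; rewrite lexx orbT.
exists (fun l => if l is 0%N then fset0 else D l (g l)); split=> //.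
- move=> [//|l] x /fset1UP[->|/(pred_lt (Pb _ (gb _))) xg]; first exact: gb.
  exact: lt_trans xg (gb _).
- move=> [|l]; first exact: fsub0set.
  apply/fsubsetP => x xg; apply: Dtrans (gS _); first exact: gb.
  by apply: Dmono xg; rewrite ?gb ?leqnSn.
- move=> x xb; have [m em] := ecov x xb; have [l sl] := sfirst m.+1.
  have := sbound l m; rewrite sl em => /(_ (ltnSn _)) xg.
  have [k xk] : exists k, x \in D k (g l).
    move: xg; rewrite le_eqVlt => /orP[/eqP->|xg]; first by exists 0%N.
    by have [k xk] := pred_cover (Pb _ (gb l)) xg; exists k; rewrite !inE xk orbT.
  exists (maxn k l).+1; apply: (Dtrans _ _ (g l)) (gle _ _ _); rewrite ?gb //.
    by apply: Dmono xk; rewrite ?gb // leqW // leq_maxl.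
  by rewrite leqW // leq_maxr.
- move=> [//|l] x y /fset1UP[->|xg].
    rewrite !inE; have [->|_] /= := eqVneq y (g l.+1).
      rewrite ltxx; apply/negP => /(pred_lt (Pb _ (gb _))); by rewrite ltxx.
    by apply/idP/andP => [yg|[]//]; split=> //; exact: pred_lt (Pb _ (gb _)) _ _ yg.
  rewrite (pred_coherent (Pb _ (gb l.+1))) // !inE.
  have [->|//] := eqVneq y (g l.+1).
  by rewrite [g _ < x]ltNge (ltW (pred_lt (Pb _ (gb _)) xg)) !andbF.
Qed.

Theorem tower_exists : is_omega1 W ->
  exists D : nat -> W -> {fset W}, tower D.
Proof.
move=> [wo seg _].
have [||P PP] := @wf_choice W _ _ (fun=> fset0) predecessors (well_order_founded wo).
- move=> P P' b Q PP' [Qlt Qmono Q0 Qcov Qcoh]; split=> // l x y xQ.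
  by rewrite -PP' ?Qcoh //; exact: Qlt xQ.
- by move=> P b; apply: predecessors_extend; exact: seg.
exists (fun l x => x |` P x l).
have plt l x y : x \in P y l -> x < y by exact: (pred_lt (PP y)).
split.
- by move=> l x; rewrite fset1U1.
- move=> l x y z /fset1UP[->//|xy] /fset1UP[<-|yz]; first by rewrite !inE xy orbT.
  by move: xy; rewrite (pred_coherent (PP z) _ yz) !inE => /andP[-> _]; rewrite orbT.
- move=> l x y /fset1UP[//|/plt xy] /fset1UP[//|/plt yx].
  by have := lt_trans xy yx; rewrite ltxx.
- move=> l x y z /fset1UP[->|xz] /fset1UP[->|yz]; rewrite !inE ?eqxx ?xz ?yz ?orbT; [by left|by right|by left|].
  have [xy|yx|->] := ltgtP x y; [left|right|by left].
  + by rewrite (pred_coherent (PP z) _ yz) xz xy orbT.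
  + by rewrite (pred_coherent (PP z) _ xz) yz yx orbT.
- move=> j l x /subnK <-; elim: (l - j)%N => // k IH; apply: fsubset_trans IH _.
  by apply: fsetUS; exact: pred_mono (PP x) _.
- by move=> x; rewrite (pred0 (PP x)) fsetU0.
- move=> x y; have [xy|yx|->] := ltgtP x y.
  + by have [l xl] := pred_cover (PP y) xy; exists l; left; rewrite !inE xl orbT.
  + by have [l yl] := pred_cover (PP x) yx; exists l; right; rewrite !inE yl orbT.
  + by exists 0%N; left; rewrite fset1U1.
Qed.

End Tower.

(** * Hechler forcing and bounding *)

Section HechlerForcing.
Local Open Scope order_scope.
Local Open Scope fset_scope.

(** A condition is a finite piece of the dominating function together with a finite
set of points [x] such that all later values must be at least those of [G x]. *)
Definition hechler (T : choiceType) (G : T -> nat -> nat) : Type :=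
  (seq nat * {fset T})%type.

Section Hechler.
Context {T : choiceType} {G : T -> nat -> nat}.
Implicit Types p q : hechler G.

HB.instance Definition _ := Choice.on (hechler G).

Definition hechler_le p q :=
  `[< [/\ prefix q.1 p.1, q.2 `<=` p.2 & forall x l, x \in q.2 ->
    (size q.1 <= l < size p.1)%N -> (G x l <= nth 0%N p.1 l)%N] >].

Lemma hechler_le_refl : reflexive hechler_le.
Proof.
move=> p; apply/asboolP; split; rewrite ?prefix_refl // => x l _ /andP[pl].
by rewrite ltnNge pl.
Qed.

Lemma hechler_le_anti : antisymmetric hechler_le.
Proof.
move=> [s A] [t B] /andP[/asboolP[/= ts BA _] /asboolP[/= st AB _]]; congr (_, _).
  have /eqP sz : size s == size t by rewrite eqn_leq !size_prefix.
  by move: st; rewrite prefixE sz take_size => /eqP.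
by apply/eqP; rewrite eqEfsubset AB.
Qed.

Lemma hechler_le_trans : transitive hechler_le.
Proof.
move=> [t B] [s A] [u C] /asboolP[/= ts BA Bs] /asboolP[/= ut CB Ct].
apply/asboolP; split=> /=; [exact: prefix_trans ut ts|exact: fsubset_trans CB BA|].
move=> x l xC /andP[ul ls]; have [lt|tl] := ltnP l (size t); last first.
  by apply: Bs; rewrite ?tl //; exact: (fsubsetP CB).
have -> : nth 0%N s l = nth 0%N t l.
  by case/prefixP: ts => v ->; rewrite nth_cat lt.
by apply: Ct => //; rewrite ul.
Qed.

Fact hechler_display : Order.disp_t. Proof. exact: Order.Disp tt tt. Qed.

HB.instance Definition _ := Order.Le_isPOrder.Build hechler_display (hechler G)
  hechler_le_refl hechler_le_anti hechler_le_trans.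

(** Conditions with the same first component have a common extension: unite the
second components. *)
Lemma hechler_centered : sigma_centered (hechler G).
Proof.
exists (fun m => [set p : hechler G | choice.pickle p.1 = m]); split.
  by apply/seteqP; split=> // p _; exists (choice.pickle p.1).
move=> m F Fm; have [->|[p pF]] := fset_0Vmem F.
  by exists (([::], fset0) : hechler G).
exists ((p.1, \bigcup_(q <- F) q.2) : hechler G) => q qF.
have qp : q.1 = p.1 by apply: (pcan_inj choice.pickleK); rewrite (Fm q qF) (Fm p pF).
apply/asboolP; split=> /=; first by rewrite qp prefix_refl.
- exact: (bigfcup_sup (fun q : hechler G => q.2) qF).
- by move=> x l _; rewrite qp => /andP[pl]; rewrite ltnNge pl.
Qed.

(** Extend the finite function by the maxima of the finitely many functions to be
dominated. *)
Lemma hechler_dense x m :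
  poset_dense [set p : hechler G | x \in p.2 /\ (m <= size p.1)%N].
Proof.
move=> [s A].
pose h l := (\max_(y <- A) G y l)%N.
exists ((s ++ [seq h l | l <- iota (size s) m], x |` A) : hechler G) => /=.
  by rewrite fset1U1 size_cat size_map size_iota leq_addl.
apply/asboolP; split=> /=; [exact: prefix_prefix|exact: fsubsetU1|].
move=> y l yA /andP[sl]; rewrite size_cat size_map size_iota => lm.
rewrite nth_cat ltnNge sl /= (nth_map 0%N) ?size_iota ?ltn_subLR //.
rewrite nth_iota ?ltn_subLR // subnKC // /h.
exact: (leq_bigmax_seq (F := fun y => G y l)).
Qed.

End Hechler.

Lemma uncountable_surjection (T : choiceType) : ~ countable [set: T] ->
  exists c : T -> nat, forall m, exists x, c x = m.
Proof.
move=> unc.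
have /infiniteP/card_leP[i] : infinite_set [set: T].
  by apply: contra_not unc; exact: finite_set_countable.
pose e m := \val (i (to_setT m)).
have einj : injective e.
  move=> m k /val_inj /(inj (f := i)); rewrite !inE => /(_ I I).
  by move=> /(congr1 \val).
exists (fun x => xget 0%N [set m | e m = x]) => m; exists (e m).
by case: xgetP => [k _ /= /einj|/(_ m) []].
Qed.

(** A filter that meets the dense sets of [hechler_dense] for all pairs
[(x, c x)], where [c] is onto [nat], defines a total function and takes every
[x] into account.  Using a surjection [c] keeps the index set equal to [T]. *)
Theorem MA_bounded (T : choiceType) : ~ countable [set: T] ->
  MA_sigma_centered T -> forall G : T -> nat -> nat,
  exists g : nat -> nat, forall x, exists L, forall l, (L <= l)%N -> (G x l <= g l)%N.
Proof.
move=> /uncountable_surjection[c csurj] MA G.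
have [F [_ Fdir] Fdense] := MA _ (hechler G) hechler_centered _
  (fun x => @hechler_dense _ G x (c x)).
have compat p q : F p -> F q -> exists r, [/\ F r, r <= p & r <= q].
  move=> Fp Fq; have [|r [Fr rpq]] := Fdir [fset p; q].
    by move=> r; rewrite /= !inE => /orP[] /eqP->.
  by exists r; split=> //; apply: rpq; rewrite /= !inE eqxx ?orbT.
have /choice[s sP] l : exists s, exists2 p, F p & s = p.1 /\ (l < size p.1)%N.
  have [x cx] := csurj l.+1; have [p [Fp [_ lp]]] := Fdense x.
  by exists p.1, p => //; rewrite -cx.
exists (fun l => nth 0%N (s l) l) => x; have [p [Fp [xp _]]] := Fdense x.
exists (size p.1) => l pl; have [q Fq [-> lq]] := sP l.
have [r [_ /asboolP[_ _ rp] /asboolP[/prefixP[t rt] _ _]]] := compat p q Fp Fq.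
have := rp x l xp; rewrite pl rt size_cat nth_cat lq => -> //.
by rewrite (leq_trans lq) ?leq_addr.
Qed.

End HechlerForcing.

(** * Ranking a linked family *)

Section LinkedRank.
Local Open Scope fset_scope.

(** Linkedness speaks of exactly [n] distinct sets.  A piece with at least [n]
members takes care of fewer sets, because they can be completed to [n]; a piece
with fewer members is finite, and there [f] is made injective. *)
Theorem linked_rank (T : choiceType) (n : nat) (C : set {fset T}) :
  downward_closed C -> sigma_linked_family n C ->
  exists f : {fset T} -> nat, forall (b : {fset T}) (A : {fset {fset T}}),
    C b -> (#|` A| <= n)%N ->
    (forall a, a \in A -> f a = f b) -> C (\bigcup_(a <- A) a).
Proof.
move=> Cdown [Cs [_ CsC Cs_linked]].
have CsP a : C a <-> exists m, Cs m a by rewrite -CsC; split=> [[m _ am]|[m am]]; exists m.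
pose rich m := exists2 B : {fset {fset T}}, #|` B| = n & ([set` B] `<=` Cs m)%classic.
pose poor := (\bigcup_(m in [set m | ~ rich m]) Cs m)%classic.
have /countable_injP[u uinj] : countable poor.
  apply: bigcup_countable => [|m /= poorm]; first exact: countableP.
  apply: finite_set_countable; apply: contrapT => /(infinite_set_fset n)[B BC nB].
  apply: poorm; have [E [_ EB En]] := fsubset_interpolate (fsub0set B) (leq0n n) nB.
  by exists E => // a /= aE; apply: BC; exact: (fsubsetP EB).
(* f is 0 outside C, odd on large pieces and even on small ones. *)
have /choice[f fP] a : exists k, if pselect (C a) is left _
    then (exists2 m, k = m.*2.+1 & Cs m a /\ rich m) \/ (k = (u a).*2.+2 /\ poor a)
    else k = 0%N.
  case: pselect => [/CsP[m am]|_]; last by exists 0%N.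
  have [rm|nrm] := pselect (rich m); first by exists m.*2.+1; left; exists m.
  by exists (u a).*2.+2; right; split=> //; exists m.
have f_pos a : C a <-> f a <> 0%N.
  have := fP a; case: pselect => [Ca fa|nCa ->]; split=> // _.
  by case: fa => [[m -> _]|[-> _]].
exists f => b A Cb An fA.
have AC a : a \in A -> C a by move=> /fA fab; apply/f_pos; rewrite fab; exact/f_pos.
have := fP b; case: pselect => // _ [[m fb [_ [B Bn BC]]]|[fb bpoor]].
- have ACs a : a \in A -> Cs m a.
    move=> aA; have := fP a; rewrite (fA a aA) fb; case: pselect => [_|/(_ (AC a aA))//].
    case=> [[k [/double_inj <-] []//]|[]].
    by move=> [e]; have := congr1 odd e; rewrite /= !odd_double.
  have [|E [AE EAB En]] := @fsubset_interpolate _ A (A `|` B) n (fsubsetUl A B) An.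
    by rewrite -Bn fsubset_leq_card // fsubsetUr.
  apply: (Cdown _ (\bigcup_(a <- E) a)).
    apply/bigfcupsP => a aA _; exact: (bigfcup_sup id (fsubsetP AE _ aA)).
  apply: (Cs_linked m) => // a /= /(fsubsetP EAB) /fsetUP[/ACs//|aB]; exact: BC.
- suff Ab a : a \in A -> a = b.
    by apply: Cdown Cb; apply/bigfcupsP => a /Ab -> _.
  move=> aA; have := fP a; rewrite (fA a aA) fb; case: pselect => [_|/(_ (AC a aA))//].
  case=> [[m [e] _]|[[/double_inj uab] apoor]].
    by have := congr1 odd e; rewrite /= !odd_double.
  by apply/esym/uinj; rewrite ?inE.
Qed.

End LinkedRank.

(** * Similarity by profiles *)

Section Profiles.
Local Open Scope fset_scope.

(** Comparability of distinct points is postponed to the level [maxn (L x) (L y)]. *)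
Lemma tower_threshold (T : choiceType) (D : nat -> T -> {fset T}) (L : T -> nat) :
  tower D -> tower (fun l x =>
    if (L x <= l)%N then [fset y in D l x | (L y <= l)%N] else [fset x]).
Proof.
move=> [Drefl Dtrans Danti Dtree Dmono D0 Dtotal].
set E := fun l x => _.
have EP l x y : (y \in E l x) = (y == x) || [&& y \in D l x, (L x <= l)%N & (L y <= l)%N].
  rewrite /E; case: (leqP (L x) l) => Lx; rewrite !inE ?andbF ?orbF //=.
  by have [->|//] := eqVneq; rewrite Drefl Lx.
split.
- by move=> l x; rewrite EP eqxx.
- move=> l x y z; rewrite !EP => /orP[/eqP->//|/and3P[xy Ly Lx]].
  case/orP=> [/eqP<-|/and3P[yz Lz _]]; first by rewrite xy Ly Lx orbT.
  by rewrite (Dtrans _ _ _ _ xy yz) Lz Lx orbT.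
- move=> l x y; rewrite !EP => /orP[/eqP//|/and3P[xy _ _]] /orP[/eqP//|/and3P[yx _ _]].
  exact: Danti xy yx.
- move=> l x y z; rewrite !EP => /orP[/eqP->|/and3P[xz Lz Lx]] /orP[/eqP->|/and3P[yz Lz' Ly]].
  + by left; rewrite eqxx.
  + by right; rewrite yz Lz' Ly !orbT.
  + by left; rewrite xz Lz Lx !orbT.
  + by case: (Dtree _ _ _ _ xz yz) => h; [left|right]; rewrite h Lx Ly orbT.
- move=> j l x jl; apply/fsubsetP => y; rewrite !EP => /orP[->//|/and3P[yx Lx Ly]].
  by rewrite (fsubsetP (Dmono _ _ x jl) _ yx) (leq_trans Lx jl) (leq_trans Ly jl) orbT.
- move=> x; apply/fsetP => y; rewrite EP D0 !inE.
  by case: eqVneq.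
- move=> x y; have [l xy] := Dtotal x y.
  exists (maxn l (maxn (L x) (L y))); set m := maxn _ _.
  have [lm Lx Ly] : [/\ (l <= m)%N, (L x <= m)%N & (L y <= m)%N].
    by rewrite /m !leq_max !leqnn !orbT.
  rewrite !EP Lx Ly; case: xy => [/(fsubsetP (Dmono _ _ _ lm))|/(fsubsetP (Dmono _ _ _ lm))] ->.
  + by left; rewrite orbT.
  + by right; rewrite orbT.
Qed.

Section Profile.
Context {T : choiceType} (D : nat -> T -> {fset T}) (f : {fset T} -> nat).
Context (towerD : tower D).
Implicit Types (x y z : T).

Let trefl := tower_refl towerD.
Let ttrans := tower_trans towerD.
Let tmono := tower_mono towerD.

(** The height of a point in its tree order, starting at 1. *)
Definition height l x := #|` D l x|.

(** The element of height [i] of [D l x]; the value is [x] if there is none. *)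
Definition node l x i := xget x [set y | y \in D l x /\ height l y = i].

(** The values of [f] on all subsets of [D l x], a subset being given by the heights
of its elements. *)
Definition rank_of l x (I : seq nat) := f [fset y in D l x | height l y \in I].

Definition ranks_above l x := [set r | exists2 y, x \in D l y & r = rank_of l y].

(** Nodes of the same height are compared, and not only [x] and [y], in order that
similarity passes to predecessors and to lower levels; [ranks_above] is what
makes [x] and [y] lie below copies of the same sets. *)
Definition profile_eq l x y := height l x = height l y /\
  forall i k j, (j <= l)%N ->
    [/\ height j (node l x i) = height j (node l y i),
        ranks_above j (node l x i) = ranks_above j (node l y i)
      & (node l x i \in D j (node l x k)) = (node l y i \in D j (node l y k))].

Lemma height_mono l x y : x \in D l y -> (height l x <= height l y)%N.
Proof.
move=> xy; apply/fsubset_leq_card/fsubsetP => z zx; exact: ttrans zx xy.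
Qed.

(** Comparable points of the same height have the same predecessors. *)
Lemma height_inj l x y z : x \in D l z -> y \in D l z ->
  height l x = height l y -> x = y.
Proof.
have eqh u v : u \in D l v -> height l u = height l v -> u = v.
  move=> uv huv; apply: (tower_anti towerD) (uv) _.
  have /eqP -> : D l u == D l v; last exact: trefl.
  rewrite eqEfcard; apply/andP; split; last by rewrite -/(height l v) -huv.
  by apply/fsubsetP => w wu; exact: ttrans wu uv.
move=> xz yz hxy; case: (tower_tree towerD xz yz) => [xy|yx]; first exact: eqh.
by apply/esym/eqh.
Qed.

Lemma node_height l x y : y \in D l x -> node l x (height l y) = y.
Proof.
move=> yx; rewrite /node; case: xgetP => [z _ /= [zx hz]|/(_ y) []//].
exact: height_inj zx yx hz.
Qed.

Lemma node_mem l x i : node l x i \in D l x.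
Proof. by rewrite /node; case: xgetP => [z _ /= []//|_]; exact: trefl. Qed.

Lemma node_self l x : node l x (height l x) = x.
Proof. exact: node_height (trefl _ _). Qed.

Lemma node_default l x i : (forall y, y \in D l x -> height l y <> i) ->
  node l x i = x.
Proof.
by move=> none; rewrite /node; case: xgetP => [z _ /= [/none]|].
Qed.

Lemma profile_eq_refl l x : profile_eq l x x. Proof. by split. Qed.

Lemma profile_eq_sym l x y : profile_eq l x y -> profile_eq l y x.
Proof. by move=> [hxy e]; split=> // i k j /(e i k)[]; split. Qed.

Lemma profile_eq_trans l x y z :
  profile_eq l x y -> profile_eq l y z -> profile_eq l x z.
Proof.
move=> [hxy exy] [hyz eyz]; split; first exact: etrans hxy hyz.
move=> i k j jl; have [e1 e2 e3] := exy i k j jl; have [d1 d2 d3] := eyz i k j jl.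
by split; [exact: etrans e1 d1|exact: etrans e2 d2|exact: etrans e3 d3].
Qed.

(** A node of [D j (node l x k)] is also a node of [D l x], with the same index on
the side of [x']; this reduces all clauses to those known at level [l]. *)
Lemma profile_eq_node j l x x' k : (j <= l)%N -> profile_eq l x x' ->
  profile_eq j (node l x k) (node l x' k).
Proof.
move=> jl [hx exx'].
have nodeE i : exists m, node j (node l x k) i = node l x m /\
    node j (node l x' k) i = node l x' m.
  have transfer u u' : height l u = height l u' ->
      (forall i k j, (j <= l)%N ->
        [/\ height j (node l u i) = height j (node l u' i),
            ranks_above j (node l u i) = ranks_above j (node l u' i)
          & (node l u i \in D j (node l u k)) = (node l u' i \in D j (node l u' k))]) ->
      (exists2 y, y \in D j (node l u k) & height j y = i) ->
      exists m, node j (node l u k) i = node l u m /\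
        node j (node l u' k) i = node l u' m.
    move=> hu euu' [y yu hy]; exists (height l y).
    have yx : y \in D l u.
      exact: ttrans (fsubsetP (tmono _ jl) _ yu) (node_mem _ _ _).
    have [hm _ mm] := euu' (height l y) k j jl.
    rewrite node_height // in hm mm; rewrite node_height //.
    split; first by rewrite -hy node_height.
    by rewrite -hy hm node_height // -mm.
  have [ex|nex] := pselect (exists2 y, y \in D j (node l x k) & height j y = i).
    exact: transfer.
  have [ex'|nex'] := pselect (exists2 y, y \in D j (node l x' k) & height j y = i).
    have [|m [e1 e2]] := transfer x' x (esym hx) _ ex'; last by exists m.
    by move=> i1 k1 j1 /(exx' i1 k1)[]; split.
  exists k; split; apply: node_default => y yx hy; [apply: nex|apply: nex'];
    by exists y.
split; first by have [] := exx' k k j jl.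
move=> i m p pj; have [i1 [-> ->]] := nodeE i; have [m1 [-> ->]] := nodeE m.
exact: exx' (leq_trans pj jl).
Qed.

Lemma profile_eq_similarity : similarity D profile_eq.
Proof.
split.
- exact: profile_eq_refl.
- exact: profile_eq_sym.
- exact: profile_eq_trans.
- move=> j l x y jl exy; have [hxy _] := exy.
  by have := profile_eq_node (height l x) jl exy; rewrite {2}hxy !node_self.
- move=> j l x x' y jl exx' yx; have [hx nodes] := exx'.
  have [_ _] := nodes (height l y) (height l x) j jl.
  have yx' := fsubsetP (tmono _ jl) _ yx.
  rewrite node_height // node_self yx {1}hx node_self => /esym y'x'.
  exists (node l x' (height l y)) => //.
  by have := profile_eq_node (height l y) (leqnn l) exx'; rewrite node_height.
- by move=> l x y z xz yz [hxy _]; exact: height_inj xz yz hxy.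
Qed.

Lemma profile_eq_ranks_above l x y : profile_eq l x y ->
  ranks_above l x = ranks_above l y.
Proof.
move=> [hxy nodes]; have [_ + _] := nodes (height l x) 0%N l (leqnn l).
by rewrite {2}hxy !node_self.
Qed.

(** Each [x] in [X] is similar to a point below [z], so it lies below some [v x] with
the same ranks as [z]; take the subset of [D l (v x)] with the heights of [a']. *)
Lemma profile_eq_amalgamates n (C : set {fset T}) : downward_closed C ->
  (forall (b : {fset T}) (A : {fset {fset T}}), C b -> (#|` A| <= n)%N ->
      (forall a, a \in A -> f a = f b) -> C (\bigcup_(a <- A) a)) ->
  amalgamates D profile_eq n C.
Proof.
move=> Cdown Cf l z a' X a a'z Ca' Xn Xz aX.
pose I := [seq height l y | y <- a'].
have /choice[v vP] x : exists v, x \in X -> x \in D l v /\ rank_of l v = rank_of l z.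
  have [xX|] := boolP (x \in X); last by exists x.
  have [w wz /profile_eq_ranks_above exw] := Xz x xX.
  have : ranks_above l w (rank_of l z) by exists z.
  by rewrite -exw => -[v xv ->]; exists v.
pose part x := [fset y in D l x | height l y \in I].
have partz : part z = a'.
  apply/fsetP => y; rewrite !inE; apply/andP/idP => [[yz /mapP[w wa' hyw]]|ya'].
    by rewrite (height_inj yz (fsubsetP a'z _ wa') hyw).
  by split; [exact: (fsubsetP a'z)|apply/mapP; exists y].
have fpart x : x \in X -> f (part (v x)) = f a'.
  by move=> /vP[_ /(congr1 (@^~ I))]; rewrite /rank_of -/(part _) -/(part z) partz.
have partn : (#|` [fset part (v x) | x in X]| <= n)%N.
  by apply: leq_trans Xn; exact: leq_imfset_card.
apply: Cdown (Cf _ _ Ca' partn _) => [|_ /imfsetP[x /= xX ->]]; last exact: fpart.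
apply/fsubsetP => y /aX[[x xX yx] [w wa' [hyw _]]]; apply/bigfcupP.
exists (part (v x)); first by rewrite andbT; exact: (in_imfset _ (fun x => part (v x))).

rewrite !inE (ttrans yx) ?(proj1 (vP x xX)) //=.
by rewrite hyw; apply/mapP; exists w.
Qed.

(** * Profiles have finite index *)

Context (L : T -> nat) (g : nat -> nat).
Context (tower_isolated : forall l x y, x \in D l y -> x = y \/ (L x <= l /\ L y <= l)%N).
Context (height_bound : forall l x, (L x <= l)%N -> (height l x <= g l)%N).
Context (rank_bound : forall l x (a : {fset T}), (L x <= l)%N -> a `<=` D l x ->
  (f a <= g l)%N).

(** Finitely many classes among the points whose bounds have taken effect at level
[l]. *)
Definition finite_index l (R : T -> T -> Prop) :=
  exists (F : finType) (c : T -> F), forall x y, (L x <= l)%N -> (L y <= l)%N ->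
    c x = c y -> R x y.

Lemma finite_index_and l R S : finite_index l R -> finite_index l S ->
  finite_index l (fun x y => R x y /\ S x y).
Proof.
move=> [F [c cR]] [F' [c' cS]]; exists (F * F')%type, (fun x => (c x, c' x)).
by move=> x y Lx Ly [/cR ? /cS ?]; split; auto.
Qed.

Lemma finite_index_all l m (R : nat -> T -> T -> Prop) :
  (forall i, (i < m)%N -> finite_index l (R i)) ->
  finite_index l (fun x y => forall i, (i < m)%N -> R i x y).
Proof.
elim: m => [|m IH] Rm; first by exists unit, (fun=> tt).
have [F [c cR]] := finite_index_and (IH (fun i im => Rm i (ltnW im))) (Rm m (ltnSn m)).
exists F, c => x y Lx Ly /(cR x y Lx Ly)[lower top] i.
by rewrite ltnS leq_eqVlt => /orP[/eqP->|/lower].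
Qed.

Lemma finite_index_comp l R (u : T -> T) :
  (forall x, (L x <= l)%N -> (L (u x) <= l)%N) ->
  finite_index l R -> finite_index l (fun x y => R (u x) (u y)).
Proof.
move=> Lu [F [c cR]]; exists F, (c \o u) => x y Lx Ly; apply: cR; exact: Lu.
Qed.

Lemma finite_index_nat l m (u : T -> nat) :
  (forall x, (L x <= l)%N -> (u x <= m)%N) ->
  finite_index l (fun x y => u x = u y).
Proof.
move=> um; exists 'I_m.+1, (fun x => inord (u x)) => x y Lx Ly /(congr1 val).
by rewrite /= !inordK ?ltnS ?um.
Qed.

(** Heights in [D j x] and values of [f] are at most [g l], so [rank_of j x] is
determined by a map from subsets of a finite set to a finite set. *)
Lemma finite_index_rank_of j l : (j <= l)%N ->
  finite_index l (fun x y => rank_of j x = rank_of j y).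
Proof.
move=> jl.
pose code x := [ffun A : {set 'I_(g l).+1} =>
  inord (rank_of j x [seq val i | i <- enum A]) : 'I_(g l).+1].
have subl x : D j x `<=` D l x := tmono x jl.
have jheight x : (L x <= l)%N -> (height j x <= g l)%N.
  move=> Lx; apply: leq_trans (height_bound Lx); exact: fsubset_leq_card.
exists _, code => x y Lx Ly exy; apply: funext => I.
pose A := [set i : 'I_(g l).+1 | val i \in I]%SET.
have rankA z : (L z <= l)%N -> rank_of j z I = rank_of j z [seq val i | i <- enum A].
  move=> Lz; rewrite /rank_of; congr f; apply/fsetP => w; rewrite !inE.
  have [wz|//] := boolP (w \in D j z) => /=.
  have hw : (height j w < (g l).+1)%N.
    by rewrite ltnS; exact: leq_trans (height_mono wz) (jheight z Lz).
  apply/idP/mapP => [wI|[i + ->]]; last by rewrite mem_enum inE.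
  by exists (Ordinal hw) => //; rewrite mem_enum inE.
rewrite !rankA //; have := congr1 (fun c : {ffun _ -> _} => val (c A)) exy.
rewrite !ffunE /= !inordK // ltnS.
- by apply: (rank_bound Ly); apply: fsubset_trans (fset_sub _ _) (subl y).
- by apply: (rank_bound Lx); apply: fsubset_trans (fset_sub _ _) (subl x).
Qed.

(** Points above [x], other than [x], have their bounds in effect, so a set of ranks
above [x] is a subset of one finite set. *)
Lemma finite_index_ranks_above j l : (j <= l)%N ->
  finite_index l (fun x y => ranks_above j x = ranks_above j y).
Proof.
move=> jl; have [F [c cP]] := finite_index_rank_of jl.
exists {set F}, (fun x => [set e | `[< exists2 y, x \in D j y & c y = e >]]%SET).
have up x y : (L x <= l)%N -> x \in D j y -> (L y <= l)%N.
  by move=> Lx /tower_isolated[<-//|[_ /leq_trans]]; apply.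
suff half x y : (L x <= l)%N -> (L y <= l)%N ->
    [set e | `[< exists2 z, x \in D j z & c z = e >]]%SET =
    [set e | `[< exists2 z, y \in D j z & c z = e >]]%SET ->
    (ranks_above j x `<=` ranks_above j y)%classic.
  move=> x y Lx Ly exy; apply/seteqP.
  by split; [exact: half Lx Ly exy | exact: half Ly Lx (esym exy)].
move=> Lx Ly exy _ [z xz ->].
have : c z \in [set e | `[< exists2 z, x \in D j z & c z = e >]]%SET.
  by rewrite inE; apply/asboolP; exists z.
rewrite exy inE => /asboolP[w yw cwz]; exists w => //.
by apply/esym/cP => //; [exact: up yw|exact: up xz].
Qed.

Theorem profile_eq_finite_index l : finite_index l (profile_eq l).
Proof.
have Lnode x i : (L x <= l)%N -> (L (node l x i) <= l)%N.
  by move=> Lx; case: (tower_isolated (node_mem l x i)) => [->|[]].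
have hl : finite_index l (fun x y => height l x = height l y).
  by apply: (finite_index_nat (m := g l)) => x; exact: height_bound.
have [F [c cP]] : finite_index l (fun x y => height l x = height l y /\
    forall i, (i < (g l).+2)%N -> forall k, (k < (g l).+2)%N ->
    forall j, (j < l.+1)%N ->
    (height j (node l x i) = height j (node l y i) /\
     ranks_above j (node l x i) = ranks_above j (node l y i)) /\
    (node l x i \in D j (node l x k)) = (node l y i \in D j (node l y k))).
  apply: finite_index_and => //.
  apply: finite_index_all => i _; apply: finite_index_all => k _.
  apply: finite_index_all => j; rewrite ltnS => jl.
  apply: finite_index_and; first apply: finite_index_and.
  - apply: (finite_index_comp (u := fun x => node l x i)
      (R := fun x y => height j x = height j y)) => [x|]; first exact: Lnode.
    apply: (finite_index_nat (m := g l)) => x Lx.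
    by apply: leq_trans (height_bound Lx); apply/fsubset_leq_card/tmono.
  - apply: (finite_index_comp (u := fun x => node l x i)
      (R := fun x y => ranks_above j x = ranks_above j y)) => [x|]; first exact: Lnode.
    exact: finite_index_ranks_above.
  - by exists bool, (fun x => node l x i \in D j (node l x k)).
exists F, c => x y Lx Ly /(cP x y Lx Ly)[hxy nodes]; split=> // i k j jl.
(* Beyond the bound on heights all nodes are equal to the default value. *)
pose cut i := minn i (g l).+1.
have nodecut z m : (L z <= l)%N -> node l z m = node l z (cut m).
  move=> Lz; rewrite /cut; case: leqP => // gm.
  rewrite !node_default // => w wz hw; have := height_mono wz.
  - by rewrite hw leqNgt ltnS height_bound.
  - by rewrite hw leqNgt (leq_ltn_trans (height_bound Lz)) // ltnW.
rewrite (nodecut x i Lx) (nodecut x k Lx) (nodecut y i Ly) (nodecut y k Ly).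
have cutlt m : (cut m < (g l).+2)%N by rewrite ltnS geq_minr.
by have [[? ?] ?] := nodes _ (cutlt i) _ (cutlt k) j jl.
Qed.

End Profile.

End Profiles.

(** * The colouring *)

Section BoundedTower.
Local Open Scope fset_scope.

Lemma fset_branch (T : choiceType) (D : nat -> T -> {fset T}) (x0 : T)
  (a : {fset T}) : tower D -> exists l, branch D l a.
Proof.
move=> tD; elim/fset1U_rect: a => [|x a _ [l [z az]]].
  by exists 0%N, x0; exact: fsub0set.
have [m xz] := tower_total tD x z; exists (maxn l m).
have up y : D l y `<=` D (maxn l m) y by apply: tower_mono; rewrite ?leq_maxl.
have up' y : D m y `<=` D (maxn l m) y by apply: tower_mono; rewrite ?leq_maxr.
case: xz => [xz|zx]; [exists z|exists x]; rewrite fsubUset fsub1set.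
  by rewrite (fsubsetP (up' _) _ xz) (fsubset_trans az).
rewrite (tower_refl tD) /=; apply/fsubsetP => y /(fsubsetP az)/(fsubsetP (up _)) yz.
exact: tower_trans tD _ _ _ _ yz (fsubsetP (up' _) _ zx).
Qed.

(** The function [g] dominates sizes and values of [f] at [x] from level [L x] on. *)
Theorem bounded_tower_exists (d : Order.disp_t) (W : orderType d)
    (f : {fset W} -> nat) : is_omega1 W -> MA_sigma_centered W ->
  exists (D : nat -> W -> {fset W}) (L : W -> nat) (g : nat -> nat),
  [/\ tower D,
      forall l x y, x \in D l y -> x = y \/ (L x <= l /\ L y <= l)%N,
      forall l x, (L x <= l)%N -> (#|` D l x| <= g l)%N
    & forall l x (a : {fset W}), (L x <= l)%N -> a `<=` D l x -> (f a <= g l)%N].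
Proof.
move=> hW hMA; have [D tD] := tower_exists hW; have [_ _ unc] := hW.
pose G x l := maxn #|` D l x| (\max_(a <- fpowerset (D l x)) f a).
have [g gP] := MA_bounded unc hMA G; have /choice[L LP] := gP.
exists (fun l x => if (L x <= l)%N then [fset y in D l x | (L y <= l)%N] else [fset x]).
exists L, g; split.
- exact: tower_threshold.
- move=> l x y; case: leqP => Ly; rewrite !inE; last by move/eqP; left.
  by move=> /andP[_ Lx]; right.
- move=> l x Lx; rewrite Lx; apply: leq_trans (LP x l Lx).
  by rewrite leq_max fsubset_leq_card ?fset_sub.
- move=> l x a Lx; rewrite Lx => aD; apply: leq_trans (LP x l Lx).
  rewrite leq_max; apply/orP; right.
  apply: (leq_bigmax_seq (F := f)) => //; rewrite fpowersetE.
  exact: fsubset_trans aD (fset_sub _ _).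
Qed.

End BoundedTower.

Theorem proposition16 (d : Order.disp_t) (W : orderType d) (hW : is_omega1 W)
    (hMA : MA_sigma_centered W) (n : nat) (hn : (2 <= n)%N)
    (C : set {fset W}) (hdown : downward_closed C)
    (hlinked : sigma_linked_family n C) :
  exists pi : fsets_lt W n.+2 -> 'I_2,
    sigma_linked (revincl (H0 pi)) n /\
    (C `&` fset_lt n.+1 `<=` H0 pi /\ H0 pi `<=` C).
Proof.
have [f Cf] := linked_rank hdown hlinked.
have [D [L [g [tD isolated hbound fbound]]]] := bounded_tower_exists f hW hMA.
pose sim := profile_eq D f.
have simD : similarity D sim := profile_eq_similarity f tD.
have n0 : (0 < n)%N := ltnW hn.
pose H := generated D sim n C.
have HC : H `<=` C := generated_in tD (profile_eq_amalgamates tD hdown Cf).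
have Hsub : forall a b : {fset W}, H a -> (b `<=` a)%fset -> H b.
  by move=> a b; exact: generated_sub.
have x0 : W.
  have [x|none] := pselect $|W|; first exact: unsquash x.
  have [_ _ []] := hW; rewrite (_ : [set: W] = set0); first exact: countable0.
  by apply/seteqP; split=> // x _; case: none; exact: squash x.
pose pi (G : fsets_lt W n.+2) : 'I_2 := if `[< H (val G) >] then ord0 else ord_max.
have piE G : pi G = ord0 <-> H (val G).
  rewrite /pi; case: asboolP => h; first by split.
  by split=> // /(congr1 val).
have H0E : H0 pi = H.
  apply/seteqP; split=> F HF.
    have [k Fk] := fset_branch x0 F tD.
    apply: (generated_small_subsets tD simD n0 hdown Fk) => b bF bn.
    have bn2 : (#|` b| < n.+2)%N by [].
    have /= := HF (exist _ b bn2) bF; exact: (piE _).1.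
  by move=> G GF; apply/piE; exact: Hsub HF GF.
exists pi; split; last first.
  rewrite H0E; split=> // F [CF Fn]; exact: generated_small CF Fn.
have /choice[c cP] l : exists c : W -> nat, forall x y, (L x <= l)%N ->
    (L y <= l)%N -> c x = c y -> sim l x y.
  have [F [c cP]] := profile_eq_finite_index tD isolated hbound fbound l.
  by exists (fun x => enum_rank (c x) : nat) => x y Lx Ly /val_inj/enum_rank_inj/(cP _ _ Lx Ly).
(* The type of a is a level, a similarity class of a point above a, and the set of
   heights of a. *)
pose piece l z (I : seq nat) (a : {fset W}) :=
  [/\ (L z <= l)%N, (a `<=` D l z)%fset &
      forall i, i \in I <-> exists2 y, y \in a & height D l y = i].
exists (fun m => [set p : revincl (H0 pi) | exists l z I,
  piece l z I (val p) /\ choice.pickle (l, c l z, I) = m]); split.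
  apply/seteqP; split=> // p _.
  have [k [z pz]] := fset_branch x0 (val p) tD.
  pose l := maxn k (L z).
  have pl : (val p `<=` D l z)%fset.
    by apply: fsubset_trans pz (tower_mono tD _ _); rewrite leq_maxl.
  pose I := [seq height D l y | y <- val p].
  exists (choice.pickle (l, c l z, I)) => //=; exists l, z, I; split=> //; split=> //.
    by rewrite leq_maxr.
  by move=> i; split=> [/mapP[y yp ->]|[y yp <-]]; [exists y|apply/mapP; exists y].
move=> m F Fn Fm; have [F0|[p pF]] := fset_0Vmem F.
  by have := n0; rewrite -[X in (0 < X)%N]Fn F0 cardfs0.
have [l [z [I [[Lz pz pI] pm]]]] := Fm p pF.
have Hval (q : revincl (H0 pi)) : H (val q).
  by rewrite -[H]H0E; exact: set_mem (valP q).
pose A := [fset val q | q in F]%fset.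
have HU : H (\bigcup_(a <- A) a)%fset.
  apply: (generated_bigcup tD simD (l := l) (Hval p)).
  - exact: in_imfset.
  - by exists z.
  - by apply: leq_trans (leq_imfset_card _ _ _) _; rewrite Fn.
  move=> _ /imfsetP[q /= qF ->].
  have [l' [z' [I' [[Lz' qz qI] qm]]]] := Fm q qF.
  have [ll' cc' II'] : [/\ l' = l, c l' z' = c l z & I' = I].
    by move: qm; rewrite -pm => /(pcan_inj choice.pickleK)[].
  subst l' I'; split; first by exists z'.
  move=> x xq; have /pI[y yp hxy] : height D l x \in I by apply/qI; exists x.
  exists y => //.
  rewrite -(node_height tD (fsubsetP qz _ xq)) -(node_height tD (fsubsetP pz _ yp)) hxy.
  exact: profile_eq_node (leqnn l) (cP l z' z Lz' Lz cc').
have HU0 : (\bigcup_(a <- A) a)%fset \in H0 pi by rewrite H0E inE.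
exists (SigSub HU0 : revincl (H0 pi)) => q qF.
by apply: (bigfcup_sup id) => //; exact: in_imfset.
Qed.
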